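(* Let $\rho_{AB}$ be a state on $A\otimes B$ with $A$ a qubit ($\dim A=2$) and $B$ finite-dimensional. Then $$Q^A_{\mathcal N}(\rho_{AB})=\min_{\{|a_0\rangle,|a_1\rangle\}}\frac12\big\|\rho_{AB}-\Pi_{\{|a_k\rangle\}}[\rho_{AB}]\big\|_1,$$ where the minimum is over orthonormal bases $\{|a_0\rangle,|a_1\rangle\}$ of $A$ and $\Pi_{\{|a_k\rangle\}}[X]=\sum_{k=0}^1(|a_k\rangle\langle a_k|\otimes\mathbb I_B)X(|a_k\rangle\langle a_k|\otimes\mathbb I_B)$ is the complete projective measurement (dephasing) on $A$ in that basis.
   Context: $\|\cdot\|_1$ is the trace norm. The negativity of a bipartite state $\tau_{X:Y}$ is $\mathcal N_{X:Y}(\tau)=(\|\tau^\Gamma\|_1-1)/2$ with $\tau^\Gamma$ the partial transpose on one party. For $A$ of dimension $m$ and an orthonormal basis $\{|a_k\rangle\}$ of $A$, the measurement interaction is the isometry $V:A\to A\otimes A'$ ($A'$ $m$-dimensional with computational basis $\{|k\rangle\}$), $V|a_k\rangle=|a_k\rangle|k\rangle$. The one-sided negativity of quantumness is $Q^A_{\mathcal N}(\rho_{AB})=\min\mathcal N_{AB:A'}\big((V\otimes\mathbb I_B)\rho_{AB}(V\otimes\mathbb I_B)^\dagger\big)$ over all orthonormal bases of $A$. *)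

(* Defs.v *)
(* Complex scalars: an arbitrary numClosedFieldType C
   (covers the complex numbers R[i]). *)
From HB Require Import structures.
From mathcomp Require Import all_boot all_order all_algebra.
From mathcomp Require Import sesquilinear spectral.
From mathcomp Require real_closed.mxtens.

Set Implicit Arguments.
Unset Strict Implicit.
Unset Printing Implicit Defensive.

Import Order.TTheory GRing.Theory Num.Theory.
Local Open Scope ring_scope.

Section QuantumDefs.
Variable C : numClosedFieldType.

Definition adjmx m n (M : 'M[C]_(m, n)) : 'M[C]_(n, m) :=
  map_mx Num.conj (M ^T).

Definition tidx m p (i : 'I_m) (j : 'I_p) : 'I_(m * p) :=
  mxtens.mxtens_index (i, j).

Definition kron m1 n1 m2 n2 (A : 'M[C]_(m1, n1)) (B : 'M[C]_(m2, n2))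
  : 'M[C]_(m1 * m2, n1 * n2) :=
  \matrix_(i, j) (A (mxtens.mxtens_unindex i).1 (mxtens.mxtens_unindex j).1 *
                  B (mxtens.mxtens_unindex i).2 (mxtens.mxtens_unindex j).2).

(* trace norm: sum of the singular values, i.e. of the square roots of the
   eigenvalues (with multiplicity) of the positive matrix X^dagger X *)
Definition trnorm m (X : 'M[C]_m) : C :=
  \sum_(i < m) sqrtC (spectral_diag (adjmx X *m X) 0 i).

Definition is_state m (rho : 'M[C]_m) : Prop :=
  [/\ adjmx rho = rho,
      forall v : 'rV[C]_m, 0 <= (v *m rho *m adjmx v) 0 0
    & \tr rho = 1].

Definition ptrans2 m p (X : 'M[C]_(m * p)) : 'M[C]_(m * p) :=
  \matrix_(i, j)
    X (tidx (mxtens.mxtens_unindex i).1 (mxtens.mxtens_unindex j).2)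
      (tidx (mxtens.mxtens_unindex j).1 (mxtens.mxtens_unindex i).2).

Definition negativity m p (tau : 'M[C]_(m * p)) : C :=
  (trnorm (ptrans2 tau) - 1) / 2%:R.

(* an orthonormal basis {|a_k>} of C^d is encoded by a unitary U : 'M_d whose
   k-th row holds the coordinates of |a_k> : |a_k> = \sum_i U k i |i> *)
Definition onb d (U : 'M[C]_d) : Prop := U \is unitarymx.

Definition ket d (U : 'M[C]_d) (k : 'I_d) : 'cV[C]_d := (row k U)^T.

Definition proj d (U : 'M[C]_d) (k : 'I_d) : 'M[C]_d :=
  ket U k *m adjmx (ket U k).

Definition cket d (k : 'I_d) : 'cV[C]_d := delta_mx k 0.

(* measurement interaction V : A -> A (x) A', V|a_k> = |a_k>|k>,
   i.e. V = \sum_k (|a_k> (x) |k>) <a_k| *)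
Definition meas_iso d (U : 'M[C]_d) : 'M[C]_(d * d, d) :=
  \sum_(k < d) kron (ket U k) (cket k) *m adjmx (ket U k).

(* post-measurement-interaction state (V (x) I_B) rho (V (x) I_B)^dagger,
   on A (x) A' (x) B, indices ordered ((A, A'), B) *)
Definition meas_state d n (U : 'M[C]_d) (rho : 'M[C]_(d * n))
  : 'M[C]_(d * d * n) :=
  let W := kron (meas_iso U) (1%:M : 'M[C]_n) in W *m rho *m adjmx W.

Definition ptrans_mid d p n (X : 'M[C]_(d * p * n)) : 'M[C]_(d * p * n) :=
  \matrix_(i, j)
   (let i1 := mxtens.mxtens_unindex (mxtens.mxtens_unindex i).1 in
    let j1 := mxtens.mxtens_unindex (mxtens.mxtens_unindex j).1 in
    X (tidx (tidx i1.1 j1.2) (mxtens.mxtens_unindex i).2)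
      (tidx (tidx j1.1 i1.2) (mxtens.mxtens_unindex j).2)).

Definition negativity_AB_A' d p n (tau : 'M[C]_(d * p * n)) : C :=
  (trnorm (ptrans_mid tau) - 1) / 2%:R.

Definition is_min_onb d (f : 'M[C]_d -> C) (m : C) : Prop :=
  (exists2 U, onb U & f U = m) /\ (forall U, onb U -> m <= f U).

Definition QN_is d n (rho : 'M[C]_(d * n)) (q : C) : Prop :=
  is_min_onb (fun U => negativity_AB_A' (meas_state U rho)) q.

Definition dephase d n (U : 'M[C]_d) (X : 'M[C]_(d * n)) : 'M[C]_(d * n) :=
  \sum_(k < d) kron (proj U k) (1%:M : 'M[C]_n) *m X
                 *m kron (proj U k) (1%:M : 'M[C]_n).

End QuantumDefs.

(* Main.v *)
Require Import Defs.
From HB Require Import structures.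
From mathcomp Require Import all_boot all_order all_algebra.
From mathcomp Require Import sesquilinear spectral.
From mathcomp Require Import polyrcf ring.
From mathcomp Require qe_rcf ordered_qelim.
From mathcomp Require real_closed.mxtens.
From Stdlib Require Import Classical.

(* For a fixed basis, write rho_kl = <a_k| rho |a_l>. Up to a unitary change of
   basis, the partial transpose of the measured state is
   \sum_(k, l) |k l><l k| (x) rho_kl, so its trace norm is the sum of those of
   the blocks rho_kl; the diagonal blocks are positive and contribute
   tr rho = 1. For a qubit, rho minus its dephasing has just the two
   off-diagonal blocks, so the two functions of the basis coincide and only the
   existence of a common minimum is left.

   Since C is an arbitrary algebraically closed field with conjugation, its
   real subfield R need not be Archimedean, and compactness has to be replaced
   by a first-order argument: R is real closed, so by quantifier elimination
   every nonempty bounded definable subset of R has a least upper bound, and a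
   coordinate function attains its minimum on a nonempty closed bounded
   definable subset of R^J. This is applied to the set of tuples (t, U, P, w)
   where U and P are unitary, P diagonalises X^* X for X = rho - dephase U rho
   with eigenvalues |w_i|^4, and t = \sum_i |w_i|^2 is the trace norm of X. *)

Import Order.TTheory GRing.Theory Num.Theory.
Local Open Scope ring_scope.

Set Implicit Arguments.
Unset Strict Implicit.
Unset Printing Implicit Defensive.

(** * The real subfield *)

Section RealPart.
Variable C : numClosedFieldType.

(** Making the real elements of [C] a type of their own lets them carry the [rcfType] structure on
    which quantifier elimination operates. *)
Record realC := RealC { realval :> C; realvalP : realval \is Num.real }.

HB.instance Definition _ := [isSub for realval].
HB.instance Definition _ := [Choice of realC by <:].
HB.instance Definition _ := [SubChoice_isSubIntegralDomain of realC by <:].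
HB.instance Definition _ := [SubIntegralDomain_isSubField of realC by <:].

Let Rle (x y : realC) := realval x <= realval y.
Let Rlt (x y : realC) := realval x < realval y.
Let Rnorm (x : realC) := RealC (normr_real (realval x)).

Let Rle0_add x y : Rle 0 x -> Rle 0 y -> Rle 0 (x + y).
Proof. exact: addr_ge0. Qed.

Let Rle0_mul x y : Rle 0 x -> Rle 0 y -> Rle 0 (x * y).
Proof. exact: mulr_ge0. Qed.

Let Rle0_anti x : Rle 0 x -> Rle x 0 -> x = 0.
Proof. by move=> x0 x0'; apply/val_inj/le_anti/andP. Qed.

Let Rsub_ge0 x y : Rle 0 (y - x) = Rle x y.
Proof. exact: subr_ge0. Qed.

Let Rle0_total x : Rle 0 x || Rle x 0.
Proof. exact: realvalP. Qed.

Let RnormN x : Rnorm (- x) = Rnorm x.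
Proof. exact/val_inj/normrN. Qed.

Let Rge0_norm x : Rle 0 x -> Rnorm x = x.
Proof. by move=> x0; apply/val_inj/ger0_norm. Qed.

Let Rlt_def x y : Rlt x y = (y != x) && Rle x y.
Proof. exact: lt_def. Qed.

HB.instance Definition _ := Num.IntegralDomain_isLeReal.Build realC
  Rle0_add Rle0_mul Rle0_anti Rsub_ge0 Rle0_total RnormN Rge0_norm Rlt_def.

Lemma realval_is_zmod_morphism : zmod_morphism realval. Proof. by []. Qed.
Lemma realval_is_monoid_morphism : monoid_morphism realval. Proof. by []. Qed.
HB.instance Definition _ := GRing.isZmodMorphism.Build realC C realval
  realval_is_zmod_morphism.
HB.instance Definition _ := GRing.isMonoidMorphism.Build realC C realval
  realval_is_monoid_morphism.

(** Take [g] = (X - a)^2 + b^2 with a and b the real and imaginary parts of [z], so b is nonzero and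
    [g] is positive. The remainder of [p] modulo [g] has degree at most 1, real coefficients and the
    root [z]; a nonzero leading coefficient would make [z] real. *)
Lemma realC_nonreal_factor (p : {poly realC}) (z : C) :
    z \isn't Num.real -> root (map_poly realval p) z ->
  exists q g : {poly realC},
    [/\ p = q * g, size g = 3 & forall y : realC, 0 < g.[y]].
Proof.
move=> zNR pz; pose a := RealC (Creal_Re z); pose b := RealC (Creal_Im z).
pose g : {poly realC} := ('X - a%:P) ^+ 2 + (b ^+ 2)%:P.
have b0 : b != 0.
  by apply: contra zNR => /eqP/(congr1 val)/= /Creal_ImP.
have szX : size (('X - a%:P) ^+ 2) = 3 by rewrite size_exp_XsubC.
have szg : size g = 3.
  by rewrite /g size_polyDl szX // (leq_ltn_trans (size_polyC_leq1 _)).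
have g0 : g != 0 by rewrite -size_poly_gt0 szg.
have gz0 : (map_poly realval g).[z] = 0.
  rewrite /g rmorphD rmorphXn /= rmorphB /= map_polyX !map_polyC /= !hornerE /=.
  rewrite {1}[z]Crect addrAC subrr add0r exprMn sqrCi mulN1r.
  by rewrite addNr.
exists (p %/ g), g; split=> // [|y]; last first.
  rewrite /g !hornerE ltr_wpDl ?sqr_ge0 // exprn_even_gt0 //=.
have sz : (size (p %% g)%R <= 2)%N.
  by rewrite -ltnS; move: (ltn_modpN0 p g0); rewrite szg.
rewrite {1}(divp_eq p g); set r := p %% g in sz *.
suff -> : r = 0 by rewrite addr0.
have rE : r = r`_1 *: 'X + (r`_0)%:P.
  apply/polyP => i; rewrite !coefE; case: i => [|[|i]] /=;
    rewrite ?(mulr0, add0r, mulr1, addr0) //.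
  by rewrite nth_default // (leq_trans sz).
have rz : val r`_1 * z + val r`_0 = 0.
  move: pz; rewrite rootE {1}(divp_eq p g) rmorphD rmorphM /= !hornerE gz0.
  rewrite mulr0 add0r -/r rE rmorphD /= map_polyZ /= map_polyX map_polyC /=.
  by rewrite !hornerE -rE => /eqP.
have r1 : r`_1 = 0.
  apply: contraNeq zNR => r1; have v1 : val r`_1 != 0 by rewrite fmorph_eq0.
  have -> : z = - (val r`_0) / val r`_1.
    apply: (mulfI v1); rewrite mulrCA divff // mulr1; apply/eqP.
    by rewrite -addr_eq0 rz.
  by rewrite realM ?realN ?realV ?realvalP.
by rewrite rE r1 scale0r add0r; move: rz; rewrite r1 mul0r add0r => /eqP;
  rewrite fmorph_eq0 => /eqP->.
Qed.

(** Induction on the degree, using a root in [C]. A nonreal root gives a positive quadratic factor,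
    and a real root outside [a, b] a linear factor of constant sign there; dividing by either keeps
    the sign condition at the endpoints. *)
Lemma realC_real_closed : Num.real_closed_axiom realC.
Proof.
move=> p a b le_ab /andP[pa pb].
(* In this form the hypothesis survives division by a factor whose values at [a] and [b] have the
   same sign, even if both are negative. *)
have {pa pb} : p.[a] * p.[b] <= 0 by rewrite mulr_le0_ge0.
have [n] := ubnP (size p); elim: n p => // n IHn p; rewrite ltnS => szp pab.
have [/size1_polyC pE|sz1] := leqP (size p) 1.
  exists a; first by rewrite lexx.
  move: pab; rewrite pE rootE !hornerC -expr2 => h.
  by rewrite -sqrf_eq0 eq_le h sqr_ge0.
have [z pz] : exists z, root (map_poly realval p) z.
  by apply/closed_rootP; rewrite size_map_poly neq_ltn sz1 orbT.
have [zR|zNR] := boolP (z \is Num.real); last first.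
  have [q [g [pE szg gpos]]] := realC_nonreal_factor zNR pz.
  have q0 : q != 0.
    by apply: contraTneq sz1; rewrite pE => ->; rewrite mul0r size_poly0.
  have g0 : g != 0 by rewrite -size_poly_gt0 szg.
  have [||x ? qx] := IHn q.
  - by move: szp; rewrite pE size_mul // szg addn3 /=; apply: leq_trans.
  - move: pab; rewrite pE !hornerM mulrACA pmulr_lle0 //.
    by rewrite mulr_gt0.
  by exists x => //; rewrite pE rootM qx.
pose r := RealC zR.
have rp : root p r by rewrite -(mapf_root realval).
have [rab|rNab] := boolP (a <= r <= b); first by exists r.
have /factor_theorem [q pE] := rp.
have q0 : q != 0.
  by apply: contraTneq sz1; rewrite pE => ->; rewrite mul0r size_poly0.
have [||x ? qx] := IHn q.
- by move: szp; rewrite pE size_mul ?polyXsubC_eq0 // size_XsubC addn2.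
- move: pab; rewrite pE !hornerM !hornerXsubC mulrACA pmulr_lle0 //.
  move: rNab; rewrite negb_and -!ltNge => /orP[ra|br].
    by rewrite mulr_gt0 ?subr_gt0 // (lt_le_trans ra).
  by rewrite nmulr_rgt0 ?subr_lt0 // (le_lt_trans le_ab).
by exists x => //; rewrite pE rootM qx.
Qed.
HB.instance Definition _ := Num.RealField_isClosed.Build realC realC_real_closed.

End RealPart.

(** * Definable sets in a real closed field *)

Lemma count_ltn (T : eqType) (a1 a2 : pred T) (s : seq T) z :
  z \in s -> a2 z -> ~~ a1 z -> subpred a1 a2 -> (count a1 s < count a2 s)%N.
Proof.
move=> zs a2z /negPf a1z sub; 
rewrite (permP (perm_to_rem zs) a1) (permP (perm_to_rem zs) a2) /= a2z a1z.
by rewrite ltnS sub_count.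
Qed.

Section DefinableSets.
Variable R : rcfType.
Import ordered_qelim.ord.
Implicit Types (e : seq R) (f : formula R) (t : GRing.term R) (S : R -> Prop).

(** A one-variable form of o-minimality: membership in [S] can change only at the finitely many
    points of [L]. *)
Definition constant_off (L : seq R) S :=
  forall x y, x < y -> (forall z, z \in L -> ~~ (x <= z <= y)) -> (S x <-> S y).

(** Induction on the number of points of [L] strictly between [s] and [b]. Such a point either is an
    upper bound of [S] and replaces [b], or lies below an element of [S] that replaces [s]. With no
    such point left, the supremum is [b] or [s]. *)
Lemma constant_off_lub (L : seq R) S s b :
    constant_off L S -> S s -> (forall x, S x -> x <= b) ->
  exists2 c, forall x, S x -> x <= c &
             forall y, y < c -> exists2 x, S x & y < x.
Proof.
move=> cS; have [n] := ubnP (count (fun z => s < z < b)%R L).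
elim: n s b => // n IHn s b; rewrite ltnS => szL Ss ubb.
have count_lt (s' b' z : R) : z \in L -> s < z < b -> ~~ (s' < z < b') ->
    s <= s' -> b' <= b ->
    (count (fun z => s' < z < b')%R L < n)%N.
  move=> zL zsb zNsb' ss' bb'; apply: leq_trans szL.
  apply: (count_ltn zL) => // x /andP[s'x xb'].
  by rewrite (le_lt_trans ss') // (lt_le_trans xb').
have [[z zL zsb]|noz] := classic (exists2 z, z \in L & s < z < b).
  have [zub|zNub] := classic (forall x, S x -> x <= z).
    apply: (IHn s z) => //; apply: (count_lt _ _ z) => //.
      by rewrite ltxx andbF.
    by case/andP: zsb => _ /ltW.
  have [x [Sx zx]] : exists x, S x /\ z < x.
    apply: NNPP => Nx; apply: zNub => x Sx; rewrite leNgt; apply/negP => zx.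
    by apply: Nx; exists x.
  have [sz zb] := andP zsb.
  apply: (IHn x b) => //; apply: (count_lt _ _ z) => //.
    by rewrite ltNge (ltW zx).
  by rewrite ltW // (lt_trans sz).
have [[x [Sx sx xb]]|nox] := classic (exists x, [/\ S x, s < x & x < b]).
  (* The midpoint of max(y, x) and [b] exceeds [y], and no point of [L] separates it from [x], so it
     belongs to [S]. *)
  exists b => // y yb.
  have mb : Num.max y x < b by rewrite gt_max yb xb.
  have [m1 m2] := midf_lt mb; exists ((Num.max y x + b) / 2).
    apply/(cS x) => //; first by rewrite (le_lt_trans _ m1) // le_max lexx orbT.
    move=> z zL; apply/negP => /andP[xz zy]; apply: noz; exists z => //.
    by rewrite (lt_le_trans sx) //= (le_lt_trans zy).
  by rewrite (le_lt_trans _ m1) // le_max lexx.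
have [Sb|NSb] := classic (S b); first by exists b => // y yb; exists b.
exists s => [x Sx|y ys]; last by exists s.
rewrite leNgt; apply/negP => sx; apply: nox; exists x; split=> //.
rewrite lt_neqAle ubb // andbT; apply/eqP => xb; apply: NSb; by rewrite -xb.
Qed.

Lemma rterm_horner e i t : GRing.rterm t ->
  exists p : {poly R}, forall x, GRing.eval (set_nth 0 e i x) t = p.[x].
Proof.
move=> rt.
exists (qe_rcf.eval_poly e (qe_rcf.abstrX i (qe_rcf.to_rterm t))) => x.
by rewrite qe_rcf.abstrXP qe_rcf.evalE qe_rcf.to_rtermE.
Qed.

(** A sign change needs a root in between, by the intermediate value property. The zero polynomial
    is treated apart, its roots not forming a finite list. *)
Lemma sgr_constant_off (p : {poly R}) (P : R -> bool) :
  constant_off (rootsR p) (fun x => P (Num.sg p.[x])).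
Proof.
move=> x y xy Hz; suff -> : Num.sg p.[x] = Num.sg p.[y] by [].
have [->|p0] := eqVneq p 0; first by rewrite !horner0.
have noroot : {in `[x, y], forall z, ~~ root p z}.
  move=> z; rewrite in_itv /= => zxy; apply/negP => rz.
  have : z \in rootsR p by rewrite -(roots_on_rootsR p0) inE rz.
  by move=> /Hz; rewrite zxy.
by apply: (polyrN0_itv noroot); rewrite in_itv /= ?lexx ?ltW.
Qed.

(** An atom depends only on the sign of the polynomial given by the difference of its two sides. For
    a binary connective the two exceptional lists are concatenated. *)
Lemma qf_constant_off e i f : qf_form f -> rformula f ->
  exists L, constant_off L (fun x => qf_eval (set_nth 0 e i x) f).
Proof.
have atom t1 t2 (Q : R -> R -> bool) (P : R -> bool) :
    (forall u v, Q u v = P (Num.sg (v - u))) -> GRing.rterm t1 -> GRing.rterm t2 ->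
  exists L, constant_off L (fun x => Q (GRing.eval (set_nth 0 e i x) t1)
                                       (GRing.eval (set_nth 0 e i x) t2)).
  move=> QP /(rterm_horner e i)[p1 p1E] /(rterm_horner e i)[p2 p2E].
  exists (rootsR (p2 - p1)) => x y xy Hz; rewrite !p1E !p2E !QP -!hornerN -!hornerD.
  exact: (@sgr_constant_off (p2 - p1) P).
have binary f1 f2 (op : bool -> bool -> bool) :
    (exists L, constant_off L (fun x => qf_eval (set_nth 0 e i x) f1)) ->
    (exists L, constant_off L (fun x => qf_eval (set_nth 0 e i x) f2)) ->
  exists L, constant_off L (fun x => op (qf_eval (set_nth 0 e i x) f1)
                                        (qf_eval (set_nth 0 e i x) f2)).
  move=> [L1 c1] [L2 c2]; exists (L1 ++ L2) => x y xy Hz.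
  have /(c1 x y xy) h1 : forall z, z \in L1 -> ~~ (x <= z <= y).
    by move=> z zL; apply: Hz; rewrite mem_cat zL.
  have /(c2 x y xy) h2 : forall z, z \in L2 -> ~~ (x <= z <= y).
    by move=> z zL; apply: Hz; rewrite mem_cat zL orbT.
  suff -> : qf_eval (set_nth 0 e i x) f1 = qf_eval (set_nth 0 e i y) f1.
    suff -> : qf_eval (set_nth 0 e i x) f2 = qf_eval (set_nth 0 e i y) f2 by [].
    by apply/idP/idP => /h2.
  by apply/idP/idP => /h1.
elim: f => //=.
- by move=> b _ _; exists [::].
- move=> t1 t2 _ /andP[r1 r2]; apply: (atom _ _ eq_op (fun s => s == 0)) => //.
  by move=> u v; rewrite sgr_eq0 subr_eq0 eq_sym.
- move=> t1 t2 _ /andP[r1 r2]; apply: (atom _ _ <%R (fun s => 0 < s)) => //.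
  by move=> u v; rewrite sgr_gt0 subr_gt0.
- move=> t1 t2 _ /andP[r1 r2]; apply: (atom _ _ <=%R (fun s => 0 <= s)) => //.
  by move=> u v; rewrite sgr_ge0 subr_ge0.
- move=> f1 IH1 f2 IH2 /andP[/IH1{}IH1 /IH2{}IH2] /andP[/IH1 L1 /IH2 L2].
  exact: (binary _ _ andb).
- move=> f1 IH1 f2 IH2 /andP[/IH1{}IH1 /IH2{}IH2] /andP[/IH1 L1 /IH2 L2].
  exact: (binary _ _ orb).
- move=> f1 IH1 f2 IH2 /andP[/IH1{}IH1 /IH2{}IH2] /andP[/IH1 L1 /IH2 L2].
  exact: (binary _ _ implb).
- move=> f1 IH1 /IH1{}IH1 /IH1[L c1]; exists L => x y xy Hz.
  by split; apply: contra => /(c1 x y xy Hz).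
Qed.

(** Quantifier elimination replaces [f] by an equivalent quantifier-free formula, which is constant
    off a finite list. *)
Lemma definable_lub i e f s b :
    holds (set_nth 0 e i s) f ->
    (forall x, holds (set_nth 0 e i x) f -> x <= b) ->
  exists2 c, forall x, holds (set_nth 0 e i x) f -> x <= c &
             forall y, y < c -> exists2 x, holds (set_nth 0 e i x) f & y < x.
Proof.
have rf := to_rform_rformula f.
have /andP[qff rff] := quantifier_elim_wf (@qe_rcf.wf_QE_wproj R) rf.
have [L cL] := qf_constant_off e i qff rff.
move=> fs fb; apply: (@constant_off_lub L _ s b) => //.
move=> x y xy Hz; have := cL x y xy Hz.
by rewrite -!(rwP (qe_rcf.rcf_satP _ _)).
Qed.

Lemma holds_foldr_Forall (I : seq nat) e f :
  holds e (foldr Forall f I) <->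
  forall e', {in [predC I], nth 0 e =1 nth 0 e'} -> holds e' f.
Proof.
elim: I e => /= [|i I IHi] e.
  split=> [fe e' ee'|]; last by apply.
  by apply: eq_holds fe => i; apply: ee'.
split=> [fe e' ee'|fe x].
  have /IHi := fe (nth 0 e' i); apply=> j jI.
  rewrite nth_set_nth /=; have [->//|ji] := eqVneq j i.
  by apply: ee'; rewrite !inE negb_or ji.
apply/IHi => e' ee'; apply: fe => j; rewrite !inE negb_or => /andP[ji jI].
by have := ee' j jI; rewrite nth_set_nth /= (negPf ji).
Qed.

End DefinableSets.

(** * Compactness for definable families of subsets of R^J *)

Section DefinableCompactness.
Variables (R : rcfType) (J : finType).
Import ordered_qelim.ord.
Implicit Types (P : R -> {ffun J -> R} -> Prop) (x : {ffun J -> R}).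

(* Variable 0 is reserved for a bound and variable 1 for the parameter of a
   family of subsets of R^J; coordinate [j] is variable [(enum_rank j).+2]. *)
Definition coord_env (y u : R) x : seq R := y :: u :: codom x.

Definition coord_var (j : J) : GRing.term R := GRing.Var R (enum_rank j).+2.

Lemma eval_coord_var y u x j :
  GRing.eval (coord_env y u x) (coord_var j) = x j.
Proof.
by rewrite /= (nth_map j) ?nth_enum_rank // -cardE ltn_ord.
Qed.

(** The truth of [f] must not depend on variable 0, which [definable_liminf] uses for a candidate
    lower bound. *)
Definition definable_family P :=
  exists f, forall y u x, holds (coord_env y u x) f <-> P u x.

Lemma definable_familyI P Q : definable_family P -> definable_family Q ->
  definable_family (fun u x => P u x /\ Q u x).
Proof.
by move=> [f fP] [g gQ]; exists (And f g) => y u x /=; rewrite fP gQ.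
Qed.

Lemma definable_close_coord j (c : R) :
  definable_family (fun u x => `|x j - c| < u).
Proof.
pose diff s t := GRing.Add s (GRing.Opp t) : GRing.term R.
exists (And (Lt (diff (coord_var j) (GRing.Const c)) (GRing.Var R 1))
            (Lt (diff (GRing.Const c) (coord_var j)) (GRing.Var R 1))) => y u x.
rewrite ltr_norml ltrNl opprB -(eval_coord_var y u x j).
by split=> [[h1 h2]|/andP[h1 h2]]; [apply/andP|]; split.
Qed.

Lemma definable_box (M : R) :
  definable_family (fun _ x => forall j, `|x j| <= M).
Proof.
suff [f fP] : definable_family (fun _ x =>
    forall j, j \in enum J -> `|x j| <= M).
  exists f => y u x; rewrite fP; split=> h j; last by move=> _.
  by apply: h; rewrite mem_enum.
elim: (enum J) => [|j s [f fP]]; first by exists (Bool true).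
exists (And f (And (Le (GRing.Const (- M)) (coord_var j))
                   (Le (coord_var j) (GRing.Const M)))) => y u x.
split=> [[/fP h [h1 h2]] i|h].
  rewrite inE => /predU1P[->|/h//].
  by rewrite ler_norml -(eval_coord_var y u x j); apply/andP.
split; first by apply/fP => i si; apply: h; rewrite inE si orbT.
have := h j (mem_head _ _); rewrite ler_norml -(eval_coord_var y u x j).
by move=> /andP.
Qed.

Lemma holds_Forall_coord y u f :
  holds [:: y; u] (foldr Forall f (iota 2 #|J|)) <->
  forall x, holds (coord_env y u x) f.
Proof.
(* The quantified block consists exactly of the coordinate variables; past its end both environments
   return the default value 0. *)
rewrite holds_foldr_Forall; split=> [fh x|fh e' ee'].
  apply: fh => -[|[|i]] //=; rewrite !inE mem_iota /= -leqNgt add2n !ltnS => iJ.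
  by rewrite nth_nil nth_default // size_codom.
pose x := [ffun j : J => nth 0 e' (enum_rank j).+2].
apply: eq_holds (fh x) => -[|[|i]] /=.
- by rewrite -(ee' 0%N) // !inE mem_iota.
- by rewrite -(ee' 1%N) // !inE mem_iota.
have [iJ|Ji] := ltnP i #|J|; last first.
  rewrite nth_default ?size_codom // -(ee' i.+2) ?nth_default //.
  by rewrite !inE mem_iota /= -leqNgt add2n !ltnS.
rewrite -[i]/(val (Ordinal iJ)) -(enum_valK (Ordinal iJ)).
set j := enum_val _.
by have := eval_coord_var y u x j; rewrite /= => ->; rewrite ffunE.
Qed.

Definition monotone_family P := forall u v x, u <= v -> P u x -> P v x.

(* [c] is the liminf of the [j]-th coordinate on [P u] as [u] tends to [0]. *)
Lemma definable_liminf P j M :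
    definable_family P -> monotone_family P ->
    (forall u, 0 < u -> exists x, P u x) ->
    (forall u x, P u x -> `|x j| <= M) ->
  exists c, (forall u, 0 < u -> exists2 x, P u x & `|x j - c| < u) /\
            (forall x, (forall u, 0 < u -> P u x) -> c <= x j).
Proof.
move=> [f fP] mono nonempty bounded.
(* [g] says that variable 0 bounds the coordinate from below on some [P u] with u > 0. The supremum
   of these lower bounds is the liminf. *)
pose g := Exists 1 (And (Lt (GRing.NatConst R 0) (GRing.Var R 1))
   (foldr Forall (Implies f (Le (GRing.Var R 0) (coord_var j))) (iota 2 #|J|))).
pose T (y : R) := exists2 u, 0 < u & forall x, P u x -> y <= x j.
have gT y : holds (set_nth 0 [::] 0 y) g <-> T y.
  rewrite /g /T /=.
  split=> [[u [u0 /holds_Forall_coord h]]|[u u0 h]]; exists u => //.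
    by move=> x /(fP y) /(h x); rewrite -/holds [X in _ <= X]eval_coord_var.
  split=> //; apply/holds_Forall_coord => x /= /fP /h.
  by rewrite -[X in _ <= X](eval_coord_var y u).
have T0 : T (- M).
  by exists 1 => // x /bounded; rewrite ler_norml => /andP[].
have TM y : T y -> y <= M.
  case=> u u0 h; have [x Pux] := nonempty u u0.
  apply: le_trans (h x Pux) _.
  by move/bounded: Pux; rewrite ler_norml => /andP[].
have [|y /gT/TM //|c cub club] := @definable_lub R 0 [::] g (- M) M.
  exact/gT.
exists c; split=> [u u0|x Px]; last first.
  rewrite leNgt; apply/negP => /club[y /gT[u u0 h]]; apply/negP; rewrite -leNgt.
  exact/h/Px.
have [y /gT[v v0 h] cuy] : exists2 y, holds (set_nth 0 [::] 0 y) g & c - u < y.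
  by apply: club; rewrite ltrBlDr ltrDl.
(* On [P w] the coordinate is at least y > c - u. If it were at least c + u throughout, then c + u
   would be a lower bound larger than the supremum [c]. *)
pose w := Num.min u v; have w0 : 0 < w by rewrite lt_min u0.
apply: NNPP => Nx; have : T (c + u); last first.
  by move=> /gT/cub; rewrite gerDl leNgt u0.
exists w => // x Pwx; rewrite leNgt; apply/negP => xcu; apply: Nx; exists x.
  by apply: mono Pwx; rewrite ge_min lexx.
have yx : y <= x j by apply: h; apply: mono Pwx; rewrite ge_min lexx orbT.
by rewrite ltr_distl xcu (lt_le_trans cuy).
Qed.

(** Coordinates are treated one at a time, in place of extracting successive subsequences:
    restricting [P u] to the points whose coordinate [j] is within [u] of its liminf leaves a
    definable, monotone, nonempty family. *)
Lemma definable_accumulation P (s : seq J) M :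
    definable_family P -> monotone_family P ->
    (forall u, 0 < u -> exists x, P u x) ->
    (forall u x j, P u x -> `|x j| <= M) ->
  exists c : {ffun J -> R}, forall u, 0 < u ->
    exists2 x, P u x & forall j, j \in s -> `|x j - c j| < u.
Proof.
elim: s P => [|j s IHs] P defP mono nonempty bounded.
  by exists [ffun=> 0] => u /nonempty[x Px]; exists x.
have [c [cP _]] := definable_liminf defP mono nonempty (fun u x => bounded u x j).
have [||||c' c'P] := IHs (fun u x => P u x /\ `|x j - c| < u).
- exact/definable_familyI/definable_close_coord.
- move=> u v x uv [Pu xu]; split; first exact: mono Pu.
  exact: lt_le_trans xu _.
- by move=> u /cP[x Px xc]; exists x.
- by move=> u x i [/bounded].
exists [ffun i => if i == j then c else c' i] => u /c'P[x [Px xc] xs].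
exists x => // i; rewrite inE ffunE; have [->//|_ /=] := eqVneq i j; exact: xs.
Qed.

(** For the constant family the liminf [c] is the infimum of the coordinate. The points of [K] whose
    coordinate is within [u] of [c] accumulate at some [c'], which lies in [K] by closedness and has
    coordinate [c]. *)
Lemma definable_min_coord (K : {ffun J -> R} -> Prop) (j0 : J) (M : R) :
    definable_family (fun=> K) -> (exists x, K x) ->
    (forall x j, K x -> `|x j| <= M) ->
    (forall c : {ffun J -> R},
       (forall u, 0 < u -> exists2 x, K x & forall j, `|x j - c j| < u) ->
       K c) ->
  exists2 x, K x & forall y, K y -> x j0 <= y j0.
Proof.
move=> defK nonempty bounded closed.
have mono : monotone_family (fun=> K) by [].
have [c [cP cmin]] := definable_liminf defK mono (fun _ _ => nonempty)
  (fun _ x => bounded x j0).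
have [||||c' c'P] := @definable_accumulation
    (fun u x => K x /\ `|x j0 - c| < u) (enum J) M.
- exact/definable_familyI/definable_close_coord.
- by move=> u v x uv [Ku xu]; split=> //; exact: lt_le_trans xu _.
- by move=> u /cP[x Px xc]; exists x.
- by move=> u x i [/bounded].
exists c'.
  apply: closed => u /c'P[x [Kx _] xc]; exists x => // j; exact/xc/mem_enum.
suff -> : c' j0 = c by move=> y Ky; apply: cmin.
apply/eqP; rewrite -subr_eq0 -normr_eq0; apply: contraT => nz.
have d0 : 0 < `|c' j0 - c| / 2 by rewrite divr_gt0 // lt_def nz normr_ge0.
have [x [_ xc] /(_ j0)] := c'P _ d0; rewrite mem_enum => /(_ isT) xc'.
have : `|c' j0 - c| < `|c' j0 - c|; last by rewrite ltxx.
rewrite [ltRHS]splitr; apply: le_lt_trans (ltrD xc' xc).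
by rewrite [`|x j0 - c' j0|]distrC -{1}(subrK (x j0) (c' j0)) -addrA ler_normD.
Qed.

End DefinableCompactness.

(** * Polynomial functions *)

Section PolynomialFunctions.
Variables (C : numClosedFieldType) (J : finType).
Local Notation R := (realC C).
Implicit Types (F G : {ffun J -> R} -> C) (x : {ffun J -> R}).

(** Polynomial functions in the real coordinates, with conjugation allowed since it acts on real and
    imaginary parts. [PolyExt] stands in for functional extensionality. *)
Inductive polyfun : ({ffun J -> R} -> C) -> Prop :=
| PolyCst (c : C) : polyfun (fun=> c)
| PolyCoord j : polyfun (fun x => realval (x j))
| PolyAdd F G : polyfun F -> polyfun G -> polyfun (fun x => F x + G x)
| PolyMul F G : polyfun F -> polyfun G -> polyfun (fun x => F x * G x)
| PolyConj F : polyfun F -> polyfun (fun x => (F x)^*)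
| PolyExt F G : F =1 G -> polyfun F -> polyfun G.

Lemma polyfun_sum (I : Type) (r : seq I) (P : pred I)
    (F : I -> {ffun J -> R} -> C) :
  (forall i, P i -> polyfun (F i)) ->
  polyfun (fun x => \sum_(i <- r | P i) F i x).
Proof.
move=> polyF; elim: r => [|i r IHr].
  by apply: PolyExt (PolyCst 0) => x; rewrite big_nil.
have [Pi|NPi] := boolP (P i).
  by apply: PolyExt (PolyAdd (polyF i Pi) IHr) => x; rewrite big_cons Pi.
by apply: PolyExt IHr => x; rewrite big_cons (negPf NPi).
Qed.

Lemma polyfun_opp F : polyfun F -> polyfun (fun x => - F x).
Proof.
by move=> /(PolyMul (PolyCst (-1))); apply: PolyExt => x; rewrite mulN1r.
Qed.

(** Splitting into real and imaginary parts turns an equation F x = 0 over [C] into two first-order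
    equations over R. *)
Lemma polyfun_term F : polyfun F -> exists t1 t2 : GRing.term R,
  forall y u x, F x = realval (GRing.eval (coord_env y u x) t1)
                    + 'i * realval (GRing.eval (coord_env y u x) t2).
Proof.
have evalD (e : seq R) t s : realval (GRing.eval e (GRing.Add t s)) =
    realval (GRing.eval e t) + realval (GRing.eval e s) by exact: rmorphD.
have evalM (e : seq R) t s : realval (GRing.eval e (GRing.Mul t s)) =
    realval (GRing.eval e t) * realval (GRing.eval e s) by exact: rmorphM.
have evalN (e : seq R) t : realval (GRing.eval e (GRing.Opp t)) =
    - realval (GRing.eval e t) by exact: rmorphN.
elim=> {F}.
- move=> c; exists (GRing.Const (RealC (Creal_Re c))).
  by exists (GRing.Const (RealC (Creal_Im c))) => y u x; exact: Crect.
- move=> j; exists (coord_var R j), (GRing.NatConst R 0) => y u x.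
  by rewrite eval_coord_var [GRing.eval _ _]mulr0n rmorph0 mulr0 addr0.
- move=> F G _ [t1 [t2 Ft]] _ [s1 [s2 Gs]].
  exists (GRing.Add t1 s1), (GRing.Add t2 s2) => y u x.
  by rewrite (Ft y u) (Gs y u) !evalD mulrDr addrACA.
- move=> F G _ [t1 [t2 Ft]] _ [s1 [s2 Gs]].
  exists (GRing.Add (GRing.Mul t1 s1) (GRing.Opp (GRing.Mul t2 s2))).
  exists (GRing.Add (GRing.Mul t1 s2) (GRing.Mul t2 s1)) => y u x.
  rewrite (Ft y u) (Gs y u) !evalD evalN !evalM.
  move: (realval (GRing.eval _ t1)) (realval (GRing.eval _ t2)) => a b.
  move: (realval (GRing.eval _ s1)) (realval (GRing.eval _ s2)) => c d.
  transitivity (a * c + 'i ^+ 2 * (b * d) + 'i * (a * d + b * c)).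
    by ring.
  by rewrite sqrCi mulN1r.
- move=> F _ [t1 [t2 Ft]]; exists t1, (GRing.Opp t2) => y u x.
  by rewrite (Ft y u) conjC_rect ?realvalP // evalN mulrN.
- by move=> F G FG _ [t1 [t2 Ft]]; exists t1, t2 => y u x; rewrite -FG.
Qed.

Definition in_box (M : C) x := forall j, `|realval (x j)| <= M.

(** This supplies the continuity used for closedness. The bound [B] accompanies [L] so that the
    induction passes through products. *)
Lemma polyfun_lipschitz F M : polyfun F -> exists B L : C,
  [/\ 0 <= B, 0 <= L, forall x, in_box M x -> `|F x| <= B &
      forall x x' d, in_box M x -> in_box M x' ->
        (forall j, `|realval (x j) - realval (x' j)| <= d) ->
      `|F x - F x'| <= L * d].
Proof.
elim=> {F}.
- move=> c; exists `|c|, 0; split=> // x x' d _ _ _.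
  by rewrite subrr normr0 mul0r.
(* The absolute value makes the bound nonnegative for every [M], including those whose box is
   empty. *)
- move=> j; exists `|M|, 1; split=> // [x /(_ j) xM|x x' d _ _ /(_ j)].
    by rewrite [leRHS]ger0_norm // (le_trans _ xM).
  by rewrite mul1r.
- move=> F G _ [B [L [B0 L0 FB FL]]] _ [B' [L' [B'0 L'0 GB GL]]].
  exists (B + B'), (L + L'); split; rewrite ?addr_ge0 //.
    by move=> x xM; apply: le_trans (ler_normD _ _) _; rewrite lerD ?FB ?GB.
  move=> x x' d xM x'M xx'; rewrite opprD addrACA mulrDl.
  by apply: le_trans (ler_normD _ _) _; rewrite lerD ?FL ?GL.
- move=> F G _ [B [L [B0 L0 FB FL]]] _ [B' [L' [B'0 L'0 GB GL]]].
  exists (B * B'), (B * L' + L * B'); split; rewrite ?addr_ge0 ?mulr_ge0 //.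
    by move=> x xM; rewrite normrM ler_pM ?FB ?GB.
  move=> x x' d xM x'M xx'.
  have -> : F x * G x - F x' * G x' = F x * (G x - G x') + (F x - F x') * G x'.
    by rewrite mulrBr mulrBl addrA subrK.
  apply: le_trans (ler_normD _ _) _.
  rewrite [leRHS]mulrDl !normrM -mulrA [L * B' * _]mulrAC.
  by rewrite lerD // ler_pM ?FB ?GL ?FL ?GB.
- move=> F _ [B [L [B0 L0 FB FL]]].
  exists B, L; split=> // [x xM|x x' d xM x'M xx'].
    by rewrite norm_conjC FB.
  by rewrite -rmorphB norm_conjC FL.
- move=> F G FG _ [B [L [B0 L0 FB FL]]].
  exists B, L; split=> // [x xM|x x' d xM x'M xx'].
    by rewrite -FG FB.
  by rewrite -!FG FL.
Qed.

Lemma ler_realval (u v : R) : (u <= v) = (realval u <= realval v).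
Proof. by []. Qed.

Lemma norm_realval (u : R) : realval `|u| = `|realval u|.
Proof. by []. Qed.

Lemma in_boxE (M : R) x : in_box (realval M) x <-> forall j, `|x j| <= M.
Proof. by split=> h j; have := h j; rewrite ler_realval norm_realval. Qed.

(** The zero set in the box is definable by [polyfun_term] and closed by the Lipschitz bound, so
    [definable_min_coord] applies. *)
Lemma polyfun_min_coord F (j0 : J) (M : R) :
    polyfun F -> (exists2 x, F x = 0 & in_box (realval M) x) ->
  exists x, [/\ F x = 0, in_box (realval M) x &
    forall y, F y = 0 -> in_box (realval M) y ->
      realval (x j0) <= realval (y j0)].
Proof.
move=> polyF [x0 Fx0 x0M].
pose K x := F x = 0 /\ forall j, `|x j| <= M.
suff [x [Fx xM] xmin] : exists2 x, K x & forall y, K y -> x j0 <= y j0.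
  exists x; split=> // y Fy /in_boxE yM.
  by rewrite -ler_realval; apply: xmin.
apply: (@definable_min_coord R J K j0 M).
- apply: definable_familyI (definable_box J M).
  have [t1 [t2 Ft]] := polyfun_term polyF.
  exists (ordered_qelim.ord.And
            (ordered_qelim.ord.Equal t1 (GRing.Const 0))
            (ordered_qelim.ord.Equal t2 (GRing.Const 0))) => y u x.
  rewrite (Ft y u) /=; move: (GRing.eval _ t1) (GRing.eval _ t2) => a b.
  split=> [[-> ->]|ab]; first by rewrite !rmorph0 mulr0 addr0.
  have := congr1 (fun z => 'Re z) ab; have := congr1 (fun z => 'Im z) ab.
  rewrite Im_rect ?Re_rect ?realvalP // !raddf0 => b0 a0.
  by split; apply/val_inj.
- by exists x0; split=> //; apply/in_boxE.
- by move=> x j [].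
move=> c cP.
have cM j : `|c j| <= M.
  rewrite leNgt; apply/negP => Mc.
  have [|x [_ /(_ j) xM] /(_ j)] := cP (`|c j| - M).
    by rewrite subr_gt0.
  rewrite ltNge distrC => /negP; apply; apply: le_trans (lerB_dist _ _).
  by rewrite lerD2l lerN2.
split=> //.
have [B [L [_ L0 _ FL]]] := polyfun_lipschitz (realval M) polyF.
apply/eqP; apply: contraT => Fc.
have Fc0 : 0 < `|F c| by rewrite normr_gt0.
have L1 : 0 < L + 1 by rewrite ltr_wpDl.
(* A zero of [F] this close to [c] would give |F c| <= L |F c| / (L + 1) < |F c|; adding 1 also
   covers L = 0. *)
have u0 : 0 < `|F c| / (L + 1) by rewrite divr_gt0.
pose u := RealC (gtr0_real u0).
have [//|x [Fx xM] xc] := cP u.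
have xcu j : `|realval (x j) - realval (c j)| <= realval u.
  by rewrite -rmorphB -norm_realval -ler_realval ltW.
have := FL x c _ ((in_boxE M x).2 xM) ((in_boxE M c).2 cM) xcu.
rewrite Fx sub0r normrN /= mulrA ler_pdivlMr // mulrDr mulr1 mulrC gerDl.
by rewrite (lt_geF Fc0).
Qed.

End PolynomialFunctions.

(** * Trace norm *)

Lemma char_poly_similar (F : fieldType) n (P A : 'M[F]_n) :
  P \in unitmx -> char_poly (invmx P *m A *m P) = char_poly A.
Proof.
move=> uP; rewrite /char_poly /char_poly_mx !map_mxM.
set Q := map_mx _ P; set Qi := map_mx _ (invmx P); set B := map_mx _ A.
have QiQ : Qi *m Q = 1%:M by rewrite -map_mxM mulVmx // map_mx1.
have -> : 'X%:M - Qi *m B *m Q = Qi *m ('X%:M - B) *m Q.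
  by rewrite mulmxBr mulmxBl scalar_mxC -(mulmxA 'X%:M Qi) QiQ mulmx1.
by rewrite !det_mulmx mulrAC -det_mulmx QiQ det1 mul1r.
Qed.

Section Adjoint.
Variable C : numClosedFieldType.

Lemma adjmxE m n (A : 'M[C]_(m, n)) i j : adjmx A i j = (A j i)^*.
Proof. by rewrite !mxE. Qed.

Lemma adjmxK m n (A : 'M[C]_(m, n)) : adjmx (adjmx A) = A.
Proof. by apply/matrixP => i j; rewrite !adjmxE conjCK. Qed.

Lemma adjmxM m n p (A : 'M[C]_(m, n)) (B : 'M[C]_(n, p)) :
  adjmx (A *m B) = adjmx B *m adjmx A.
Proof. by rewrite /adjmx trmx_mul map_mxM. Qed.

Lemma adjmx_unitaryP n (P : 'M[C]_n) :
  reflect (P *m adjmx P = 1%:M) (P \is unitarymx).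
Proof. exact: unitarymxP. Qed.

Lemma adjmx_unitaryV n (P : 'M[C]_n) : P \is unitarymx -> adjmx P *m P = 1%:M.
Proof. by move=> /adjmx_unitaryP/mulmx1C. Qed.

Lemma invmx_adjmx n (P : 'M[C]_n) : P \is unitarymx -> invmx P = adjmx P.
Proof. exact: invmx_unitary. Qed.

Lemma spectral_decomp n (A : 'M[C]_n) : adjmx A *m A = A *m adjmx A ->
  A = adjmx (spectralmx A) *m diag_mx (spectral_diag A) *m spectralmx A.
Proof.
move=> nA; rewrite -invmx_adjmx ?spectral_unitarymx //.
by apply/orthomx_spectralP/normalmxP.
Qed.

Lemma unitary_diag_conj n (P A : 'M[C]_n) (d : 'rV[C]_n) : P \is unitarymx ->
  A = adjmx P *m diag_mx d *m P <-> P *m A *m adjmx P = diag_mx d.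
Proof.
move=> uP; have PP := adjmx_unitaryP _ uP; have PV := adjmx_unitaryV uP.
split=> [->|<-]; first by rewrite !mulmxA PP mul1mx -mulmxA PP mulmx1.
by rewrite !mulmxA PV mul1mx -mulmxA PV mulmx1.
Qed.

Lemma adjmx_gram_normal n (X : 'M[C]_n) (A := adjmx X *m X) :
  adjmx A *m A = A *m adjmx A.
Proof. by rewrite /A !adjmxM !adjmxK. Qed.

(** Any unitary diagonalisation computes the trace norm: the characteristic polynomial determines
    the eigenvalues with multiplicity, hence up to a permutation. *)
Lemma trnorm_diag n (X P : 'M[C]_n) (d : 'rV[C]_n) : P \is unitarymx ->
  adjmx X *m X = adjmx P *m diag_mx d *m P -> trnorm X = \sum_i sqrtC (d 0 i).
Proof.
move=> uP; rewrite /trnorm; set A := adjmx X *m X => AE.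
have char_diag (e : 'rV[C]_n) :
    char_poly (diag_mx e) = \prod_(x <- [seq e 0 i | i <- enum 'I_n]) ('X - x%:P).
  rewrite char_poly_trig ?diag_mx_is_trig // big_map enumT.
  by apply: eq_bigr => i _; rewrite mxE eqxx.
have /prod_XsubC_eq pe :
    \prod_(x <- [seq spectral_diag A 0 i | i <- enum 'I_n]) ('X - x%:P) =
    \prod_(x <- [seq d 0 i | i <- enum 'I_n]) ('X - x%:P).
  rewrite -!char_diag.
  rewrite -[RHS](char_poly_similar _ (unitarymx_unit uP)) invmx_adjmx // -AE.
  have AS := spectral_decomp (adjmx_gram_normal X).
  rewrite -/A in AS; rewrite [in RHS]AS.
  by rewrite -invmx_adjmx ?char_poly_similar ?spectral_unit ?spectral_unitarymx.
have := perm_big _ pe : \sum_(x <- _) sqrtC x = \sum_(x <- _) sqrtC x.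
by rewrite !big_map.
Qed.

Lemma gram_diag_ge0 m n (Y : 'M[C]_(m, n)) i : 0 <= (adjmx Y *m Y) i i.
Proof.
rewrite mxE sumr_ge0 // => k _; rewrite adjmxE mulrC -normCK.
by rewrite exprn_ge0.
Qed.

Lemma trnorm_decomp n (X : 'M[C]_n) :
  exists P (s : 'rV[C]_n), [/\ P \is unitarymx, forall i, 0 <= s 0 i,
    P *m (adjmx X *m X) *m adjmx P = diag_mx (map_mx (fun z => z ^+ 2) s) &
    trnorm X = \sum_i s 0 i].
Proof.
have := spectral_decomp (adjmx_gram_normal X); set A := adjmx X *m X.
have := spectral_unitarymx A; set P := spectralmx A; set d := spectral_diag A.
move=> uP /(unitary_diag_conj _ _ uP) PE.
(* The eigenvalues are the diagonal entries of the Gram matrix of X P^*. *)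
have d_ge0 i : 0 <= d 0 i.
  have := gram_diag_ge0 (X *m adjmx P) i.
  by rewrite adjmxM adjmxK !mulmxA -(mulmxA P) PE mxE eqxx.
exists P, (map_mx sqrtC d); split=> // [i||].
- by rewrite mxE sqrtC_ge0.
- by rewrite PE; congr diag_mx; apply/rowP => i; rewrite !mxE sqrtCK.
- by apply: eq_bigr => i _; rewrite mxE.
Qed.

(** The eigenvalues of [H] are values of its quadratic form at the rows of a diagonalising unitary,
    hence nonnegative, so they are the square roots of the eigenvalues of H^2. *)
Lemma trnorm_psd n (H : 'M[C]_n) : adjmx H = H ->
  (forall v : 'rV[C]_n, 0 <= (v *m H *m adjmx v) 0 0) -> trnorm H = \tr H.
Proof.
move=> hH psd.
have := @spectral_decomp _ H; rewrite hH => /(_ erefl).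
have := spectral_unitarymx H; set P := spectralmx H; set d := spectral_diag H.
move=> uP HE; have PP := adjmx_unitaryP _ uP.
have /(unitary_diag_conj _ _ uP) PE := HE.
have d_ge0 i : 0 <= d 0 i.
  have := psd (row i P); rewrite -row_mul.
  have -> : (row i (P *m H) *m adjmx (row i P)) 0 0 = (P *m H *m adjmx P) i i.
    by rewrite !mxE; apply: eq_bigr => k _; rewrite !mxE.
  by rewrite PE mxE eqxx.
have HHE : adjmx H *m H = adjmx P *m diag_mx (map_mx (fun z => z ^+ 2) d) *m P.
  rewrite hH {1 2}HE !mulmxA -[X in X *m diag_mx d *m P]mulmxA PP.
  rewrite mulmx1 -(mulmxA (adjmx P) (diag_mx d)) mulmx_diag.
  congr (_ *m diag_mx _ *m _).
  by apply/rowP => i; rewrite !mxE expr2.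
rewrite (trnorm_diag uP HHE) HE mxtrace_mulC mulmxA PP mul1mx.
by rewrite mxtrace_diag; apply: eq_bigr => i _; rewrite mxE sqrCK.
Qed.

End Adjoint.

(** * Tensor indices and block-diagonal matrices *)

Section TensorIndices.
Variable C : numClosedFieldType.

Lemma tidxK m p (i : 'I_m) (j : 'I_p) :
  mxtens.mxtens_unindex (tidx i j) = (i, j).
Proof. exact: mxtens.mxtens_indexK. Qed.

Lemma tidx_sum (V : nmodType) m p (F : 'I_(m * p) -> V) :
  \sum_k F k = \sum_i \sum_j F (tidx i j).
Proof.
rewrite pair_big (reindex (@mxtens.mxtens_index m p)) /=; last first.
  exists (@mxtens.mxtens_unindex m p) => k _.
    exact: mxtens.mxtens_indexK.
  exact: mxtens.mxtens_unindexK.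
by apply: eq_bigr => -[i j].
Qed.

Lemma tens_matrixP m p n q (A B : 'M[C]_(m * p, n * q)) :
  (forall i b j c, A (tidx i b) (tidx j c) = B (tidx i b) (tidx j c)) -> A = B.
Proof.
move=> AB; apply/matrixP => i j.
case: (mxtens.mxtens_indexP i) (mxtens.mxtens_indexP j) => i1 i2 [j1 j2].
exact: AB.
Qed.

Lemma kronE m1 n1 m2 n2 (A : 'M[C]_(m1, n1)) (B : 'M[C]_(m2, n2)) i b j c :
  kron A B (tidx i b) (tidx j c) = A i j * B b c.
Proof. by rewrite mxE !tidxK. Qed.

Lemma mul_kron1l m m' p q (A : 'M[C]_(m, m')) (M : 'M[C]_(m' * p, q)) i b j :
  (kron A (1%:M : 'M[C]_p) *m M) (tidx i b) j = \sum_k A i k * M (tidx k b) j.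
Proof.
rewrite mxE tidx_sum; apply: eq_bigr => k _.
rewrite (bigD1 b) //= big1 ?addr0 => [|c cb]; rewrite kronE mxE ?eqxx ?mulr1 //.
by rewrite eq_sym (negPf cb) mulr0 mul0r.
Qed.

Lemma mul_kron1r m m' p q (A : 'M[C]_(m', m)) (M : 'M[C]_(q, m' * p)) i b j :
  (M *m kron A (1%:M : 'M[C]_p)) j (tidx i b) = \sum_k M j (tidx k b) * A k i.
Proof.
rewrite mxE tidx_sum; apply: eq_bigr => k _.
rewrite (bigD1 b) //= big1 ?addr0 => [|c cb]; rewrite kronE mxE ?eqxx ?mulr1 //.
by rewrite (negPf cb) !mulr0.
Qed.

Lemma adjmx_kron m1 n1 m2 n2 (A : 'M[C]_(m1, n1)) (B : 'M[C]_(m2, n2)) :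
  adjmx (kron A B) = kron (adjmx A) (adjmx B).
Proof. by apply/matrixP => i j; rewrite !mxE rmorphM. Qed.

Lemma adjmx1 n : adjmx (1%:M : 'M[C]_n) = 1%:M.
Proof. by rewrite /adjmx trmx1 map_mx1. Qed.

Lemma kron11 m p : kron (1%:M : 'M[C]_m) (1%:M : 'M[C]_p) = 1%:M.
Proof.
apply: tens_matrixP => i b j c; rewrite kronE !mxE -natrM mulnb.
by rewrite (can_eq (@mxtens.mxtens_indexK m p)).
Qed.

Lemma kron1_mul m n q p (A : 'M[C]_(m, n)) (B : 'M[C]_(n, q)) :
  kron (A *m B) (1%:M : 'M[C]_p) = kron A 1%:M *m kron B 1%:M.
Proof.
apply: tens_matrixP => i b j c; rewrite kronE mul_kron1l mxE big_distrl /=.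
by apply: eq_bigr => k _; rewrite kronE mulrA.
Qed.

Lemma kron1_unitary m p (A : 'M[C]_m) : A \is unitarymx ->
  kron A (1%:M : 'M[C]_p) \is unitarymx.
Proof.
move=> /adjmx_unitaryP AA; apply/adjmx_unitaryP.
by rewrite adjmx_kron adjmx1 -kron1_mul AA kron11.
Qed.

Definition bdiag m n (G : 'I_m -> 'M[C]_n) : 'M[C]_(m * n) :=
  \matrix_(i, j) (let ib := mxtens.mxtens_unindex i in
    let jc := mxtens.mxtens_unindex j in (ib.1 == jc.1)%:R * G ib.1 ib.2 jc.2).

Lemma bdiagE m n (G : 'I_m -> 'M[C]_n) i b j c :
  bdiag G (tidx i b) (tidx j c) = (i == j)%:R * G i b c.
Proof. by rewrite mxE !tidxK. Qed.

Lemma bdiagM m n (G H : 'I_m -> 'M[C]_n) :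
  bdiag G *m bdiag H = bdiag (fun i => G i *m H i).
Proof.
apply: tens_matrixP => i b j c; rewrite bdiagE mxE tidx_sum (bigD1 i) //=.
rewrite [X in _ + X]big1 ?addr0 => [|k ki]; last first.
  by rewrite big1 // => l _; rewrite bdiagE eq_sym (negPf ki) !mul0r.
rewrite mxE big_distrr /=; apply: eq_bigr => k _.
by rewrite !bdiagE eqxx mul1r mulrCA.
Qed.

Lemma adjmx_bdiag m n (G : 'I_m -> 'M[C]_n) :
  adjmx (bdiag G) = bdiag (fun i => adjmx (G i)).
Proof.
apply: tens_matrixP => i b j c; rewrite adjmxE !bdiagE adjmxE rmorphM /=.
by rewrite conjC_nat eq_sym; case: eqP => [->|]; rewrite ?mul0r.
Qed.

Lemma bdiag_unitary m n (G : 'I_m -> 'M[C]_n) :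
  (forall i, G i \is unitarymx) -> bdiag G \is unitarymx.
Proof.
move=> uG; apply/adjmx_unitaryP; rewrite adjmx_bdiag bdiagM -kron11.
apply: tens_matrixP => i b j c; rewrite kronE bdiagE.
by rewrite (adjmx_unitaryP _ (uG i)) [(1%:M : 'M[C]_m) _ _]mxE.
Qed.

(** The diagonalising unitaries of the blocks assemble into one. Block-diagonality is asked of the
    Gram matrix X^* X alone, so that [X] may permute the blocks, as it does in both applications. *)
Lemma trnorm_bdiag m n (X T : 'M[C]_(m * n)) (Y : 'I_m -> 'M[C]_n) :
    T \is unitarymx ->
    adjmx X *m X = adjmx T *m bdiag (fun i => adjmx (Y i) *m Y i) *m T ->
  trnorm X = \sum_i trnorm (Y i).
Proof.
move=> uT; pose A i := adjmx (Y i) *m Y i; rewrite -/A.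
pose P := bdiag (fun i => spectralmx (A i)).
pose d : 'rV[C]_(m * n) := \row_k
  spectral_diag (A (mxtens.mxtens_unindex k).1) 0 (mxtens.mxtens_unindex k).2.
have uP : P \is unitarymx by apply: bdiag_unitary => i; apply: spectral_unitarymx.
have -> : bdiag A = adjmx P *m diag_mx d *m P.
  have -> : diag_mx d = bdiag (fun i => diag_mx (spectral_diag (A i))).
    apply: tens_matrixP => i b j c; rewrite bdiagE !mxE tidxK /=.
    rewrite (can_eq (@mxtens.mxtens_indexK m n)) xpair_eqE.
    by case: eqP => _; rewrite ?mul0r ?mul1r.
  rewrite adjmx_bdiag !bdiagM; apply: tens_matrixP => i b j c; rewrite !bdiagE.
  by rewrite [A i in LHS](spectral_decomp (adjmx_gram_normal (Y i))).
move=> XE; have uPT : P *m T \is unitarymx by apply: mul_unitarymx.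
rewrite (@trnorm_diag _ _ X (P *m T) d) //; last by rewrite XE adjmxM !mulmxA.
by rewrite tidx_sum; apply: eq_bigr => i _; apply: eq_bigr => j _; rewrite mxE tidxK.
Qed.

End TensorIndices.

(** * Measured states *)

Section Measurement.
Variable C : numClosedFieldType.

Definition blk d n (X : 'M[C]_(d * n)) (k l : 'I_d) : 'M[C]_n :=
  \matrix_(b, c) X (tidx k b) (tidx l c).

(* [bra U] maps the basis [a_k] to the computational one, so that the blocks of
   [in_basis U rho] are the operators <a_k| rho |a_l> on B. *)
Definition bra d (U : 'M[C]_d) : 'M[C]_d := map_mx Num.conj U.

Definition in_basis d n (U : 'M[C]_d) (X : 'M[C]_(d * n)) : 'M[C]_(d * n) :=
  kron (bra U) 1%:M *m X *m adjmx (kron (bra U) 1%:M).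

Lemma bra_unitary d (U : 'M[C]_d) : onb U -> bra U \is unitarymx.
Proof. by rewrite /bra conjC_unitary. Qed.

Lemma in_basisE d n (U : 'M[C]_d) (X : 'M[C]_(d * n)) k b l c :
  in_basis U X (tidx k b) (tidx l c) =
  \sum_i \sum_j (U k i)^* * X (tidx i b) (tidx j c) * U l j.
Proof.
rewrite /in_basis adjmx_kron adjmx1 mul_kron1r exchange_big /=.
apply: eq_bigr => j _; rewrite mul_kron1l big_distrl /=; apply: eq_bigr => i _.
by rewrite adjmxE !mxE conjCK.
Qed.

Lemma in_basisK d n (U : 'M[C]_d) (X : 'M[C]_(d * n)) : onb U ->
  X = adjmx (kron (bra U) 1%:M) *m in_basis U X *m kron (bra U) 1%:M.
Proof.
move=> /bra_unitary/(kron1_unitary n)/adjmx_unitaryV uT.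
by rewrite /in_basis !mulmxA uT mul1mx -mulmxA uT mulmx1.
Qed.

Lemma projE d (U : 'M[C]_d) k : proj U k = adjmx (bra U) *m delta_mx k k *m bra U.
Proof.
apply/matrixP => i j; rewrite !mxE big_ord1 !mxE (bigD1 k) //= big1 ?addr0.
  rewrite !mxE (bigD1 k) //= big1 ?addr0; first by rewrite !mxE !eqxx conjCK mulr1.
  by move=> l lk; rewrite !mxE (negPf lk) mulr0.
move=> l lk; rewrite !mxE big1 ?mul0r // => m _.
by rewrite !mxE (negPf lk) andbF mulr0.
Qed.

Definition offdiag d n (X : 'M[C]_(d * n)) : 'M[C]_(d * n) :=
  X - \sum_k kron (delta_mx k k) 1%:M *m X *m kron (delta_mx k k) 1%:M.

Lemma offdiagE d n (X : 'M[C]_(d * n)) k b l c :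
  offdiag X (tidx k b) (tidx l c) = (k != l)%:R * X (tidx k b) (tidx l c).
Proof.
rewrite !mxE summxE (bigD1 k) //= big1 ?addr0 => [|i ik]; last first.
  rewrite mul_kron1r big1 // => j _; rewrite mul_kron1l big1 ?mul0r // => m _.
  by rewrite mxE eq_sym (negPf ik) mul0r.
rewrite mul_kron1r (bigD1 k) //= big1 ?addr0 => [|j jk]; last first.
  by rewrite [delta_mx k k j l]mxE (negPf jk) mulr0.
rewrite mul_kron1l (bigD1 k) //= big1 ?addr0 => [|j jk]; last first.
  by rewrite mxE (negPf jk) andbF mul0r.
rewrite !mxE !eqxx mul1r eq_sym; case: eqP => [->|_] /=.
  by rewrite mulr1 subrr mul0r.
by rewrite mulr0 subr0 mul1r.
Qed.

(** Dephasing in the basis [U] is dephasing in the computational basis conjugated by the change of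
    basis. *)
Lemma sub_dephaseE d n (U : 'M[C]_d) (X : 'M[C]_(d * n)) : onb U ->
  X - dephase U X =
  adjmx (kron (bra U) 1%:M) *m offdiag (in_basis U X) *m kron (bra U) 1%:M.
Proof.
move=> uU; rewrite /offdiag mulmxBr mulmxBl -in_basisK //; congr (_ - _).
rewrite /dephase mulmx_sumr mulmx_suml; apply: eq_bigr => k _.
by rewrite projE !kron1_mul adjmx_kron adjmx1 /in_basis adjmx_kron adjmx1 !mulmxA.
Qed.

(** Dimension two enters here: each block column of [offdiag X] has a single possibly nonzero block,
    in row [swap k], so its Gram matrix is block diagonal. *)
Lemma trnorm_offdiag n (X T Y : 'M[C]_(2 * n)) : T \is unitarymx ->
    Y = adjmx T *m offdiag X *m T ->
  trnorm Y = trnorm (blk X 0 1) + trnorm (blk X 1 0).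
Proof.
move=> uT YE; pose swap (k : 'I_2) : 'I_2 := if k == 0 then 1 else 0.
rewrite (@trnorm_bdiag _ _ _ Y T (fun k => blk X (swap k) k)) //.
  rewrite !big_ord_recl big_ord0 addr0 addrC.
  by have -> : lift ord0 ord0 = 1 :> 'I_2 by apply/val_inj.
have TT := adjmx_unitaryP _ uT.
rewrite YE !adjmxM adjmxK !mulmxA -(mulmxA _ T) TT mulmx1 -(mulmxA (adjmx T)).
congr (_ *m _ *m _).
have swapN k : swap k != k by case: k => [[|[|//]] ?].
have swapP (j k : 'I_2) : j != swap k -> j = k.
  by case: j k => [[|[|//]] ?] [[|[|//]] ?] //= _; apply/val_inj.
have two (j k l : 'I_2) : k != l -> j != k -> j = l.
  by case: j k l => [[|[|//]] ?] [[|[|//]] ?] [[|[|//]] ?] //= _ _; apply/val_inj.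
apply: tens_matrixP => k b l c; rewrite bdiagE mxE tidx_sum.
have [<-|kl] := eqVneq k l.
  rewrite mul1r (bigD1 (swap k)) //= [Z in _ + Z]big1 ?addr0 => [|j /swapP->].
    rewrite mxE; apply: eq_bigr => f _.
    by rewrite !adjmxE !offdiagE !mxE swapN !mul1r.
  by rewrite big1 // => f _; rewrite adjmxE offdiagE eqxx mul0r rmorph0 mul0r.
rewrite mul0r big1 // => j _; rewrite big1 // => f _; rewrite adjmxE !offdiagE.
(* For distinct columns k and l, every row index j equals one of them and so meets a zero diagonal
   block. *)
have [->|/(two _ _ _ kl)->] := eqVneq j k; last by rewrite eqxx mul0r mulr0.
by rewrite mul0r rmorph0 mul0r.
Qed.

Lemma meas_isoE d (U : 'M[C]_d) a a' i :
  meas_iso U (tidx a a') i = U a' a * (U a' i)^*.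
Proof.
rewrite summxE (bigD1 a') //= big1 ?addr0 => [|k kn].
  rewrite mxE big_ord1 !mxE !tidxK /= eqxx mulr1.
  by [].
rewrite mxE big_ord1 !mxE !tidxK /= eq_sym (negPf kn) mulr0 mul0r.
by [].
Qed.

Lemma meas_stateE d n (U : 'M[C]_d) (X : 'M[C]_(d * n)) a a' b c c' e :
  meas_state U X (tidx (tidx a a') b) (tidx (tidx c c') e) =
  U a' a * (U c' c)^* * in_basis U X (tidx a' b) (tidx c' e).
Proof.
rewrite /meas_state adjmx_kron adjmx1 mul_kron1r in_basisE exchange_big /=.
rewrite big_distrr /=; apply: eq_bigr => j _; rewrite mul_kron1l big_distrl /=.
rewrite big_distrr /=; apply: eq_bigr => i _.
rewrite adjmxE !meas_isoE rmorphM /= conjCK.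
by ring.
Qed.

(* The partial transpose of the measured state is, up to the local basis change,
   the operator \sum_(k, l) |k l><l k| (x) <a_k| rho |a_l>. *)
Lemma trnorm_meas_state d n (U : 'M[C]_d) (X : 'M[C]_(d * n)) : onb U ->
  trnorm (ptrans_mid (meas_state U X)) =
  \sum_k \sum_l trnorm (blk (in_basis U X) k l).
Proof.
move=> uU; set S := in_basis U X; set Y := ptrans_mid _.
have YE a a' b c c' e : Y (tidx (tidx a a') b) (tidx (tidx c c') e) =
    U c' a * (U a' c)^* * S (tidx c' b) (tidx a' e).
  by rewrite /Y mxE !tidxK /= meas_stateE.
(* [T] rotates only the factor A. After it, block column (l, k) contains just the block <a_k| rho
   |a_l>, in row (k, l); hence the exchanged indices in [B]. *)
pose T := kron (kron (bra U) (1%:M : 'M[C]_d)) (1%:M : 'M[C]_n).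
have uT : T \is unitarymx by do 2!apply: kron1_unitary; apply: bra_unitary.
pose B (m : 'I_(d * d)) :=
  blk S (mxtens.mxtens_unindex m).2 (mxtens.mxtens_unindex m).1.
rewrite (@trnorm_bdiag _ _ _ Y T B) //.
  rewrite tidx_sum exchange_big /=; apply: eq_bigr => k _; apply: eq_bigr => l _.
  by rewrite /B tidxK.
apply: tens_matrixP => xx' b cc' e.
case: (mxtens.mxtens_indexP xx') => x x'; case: (mxtens.mxtens_indexP cc') => c c'.
rewrite -!/(tidx _ _).
have UU : \sum_a (U x' a)^* * U c' a = (x' == c')%:R.
  have /matrixP/(_ c' x') := adjmx_unitaryP _ uU; rewrite !mxE eq_sym => <-.
  by apply: eq_bigr => a _; rewrite adjmxE mulrC.
(* Both sides are brought to this form; on the left, orthonormality of the basis collapses the sum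
   over the row index of A. *)
transitivity ((x' == c')%:R * \sum_a' U a' x * (U a' c)^* *
    (adjmx (blk S c' a') *m blk S c' a') b e).
  transitivity (\sum_a ((U x' a)^* * U c' a * \sum_a' (U a' x * (U a' c)^* *
      \sum_f (S (tidx x' f) (tidx a' b))^* * S (tidx c' f) (tidx a' e)))).
    rewrite mxE !tidx_sum; apply: eq_bigr => a _; rewrite big_distrr /=.
    apply: eq_bigr => a' _; rewrite mulrA big_distrr /=; apply: eq_bigr => f _.
    by rewrite adjmxE !YE !rmorphM /= conjCK; ring.
  rewrite -big_distrl UU /=; have [->|_] := eqVneq x' c'; last by rewrite !mul0r.
  congr (_ * _); apply: eq_bigr => a' _; congr (_ * _).
  by rewrite mxE; apply: eq_bigr => f _; rewrite !mxE.
rewrite /T !adjmx_kron !adjmx1 mul_kron1r tidx_sum big_distrr /=.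
apply: eq_bigr => k _; rewrite (bigD1 c') //= big1 ?addr0 => [|l lc']; last first.
  by rewrite kronE [1%:M l c']mxE (negPf lc') !mulr0.
rewrite kronE [1%:M c' c']mxE eqxx mulr1 mul_kron1l (bigD1 (tidx k c')) //=.
rewrite big1 ?addr0 => [|m mk]; last by rewrite bdiagE (negPf mk) mul0r mulr0.
rewrite bdiagE eqxx mul1r kronE adjmxE [1%:M x' c']mxE /B tidxK /= !mxE conjCK.
by ring.
Qed.

End Measurement.

(** * Equality of the two functions for a fixed basis *)

Section Pointwise.
Variable C : numClosedFieldType.

Lemma blk_diag_psd d n (X : 'M[C]_(d * n)) k :
    (forall v : 'rV[C]_(d * n), 0 <= (v *m X *m adjmx v) 0 0) ->
  forall v : 'rV[C]_n, 0 <= (v *m blk X k k *m adjmx v) 0 0.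
Proof.
(* The test vector is [v] placed in block [k] and extended by zero. *)
move=> psd v; pose w : 'rV[C]_(d * n) := \row_j
  (((mxtens.mxtens_unindex j).1 == k)%:R * v 0 (mxtens.mxtens_unindex j).2).
have wE i b : w 0 (tidx i b) = (i == k)%:R * v 0 b by rewrite mxE tidxK.
have := psd w; congr (_ <= _); rewrite !mxE tidx_sum (bigD1 k) //=.
rewrite [Z in _ + Z]big1 ?addr0 => [|i ik]; last first.
  by rewrite big1 // => b _; rewrite adjmxE wE (negPf ik) mul0r rmorph0 mulr0.
apply: eq_bigr => b _; rewrite !adjmxE wE eqxx mul1r; congr (_ * _).
rewrite !mxE tidx_sum (bigD1 k) //= [Z in _ + Z]big1 ?addr0 => [|i ik]; last first.
  by rewrite big1 // => c _; rewrite wE (negPf ik) !mul0r.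
by apply: eq_bigr => c _; rewrite wE eqxx mul1r mxE.
Qed.

Lemma tr_blk d n (X : 'M[C]_(d * n)) : \sum_k \tr (blk X k k) = \tr X.
Proof.
rewrite [RHS]tidx_sum; apply: eq_bigr => k _.
by apply: eq_bigr => b _; rewrite mxE.
Qed.

Lemma sum_trnorm_blk_diag d n (U : 'M[C]_d) (rho : 'M[C]_(d * n)) :
  is_state rho -> onb U -> \sum_k trnorm (blk (in_basis U rho) k k) = 1.
Proof.
move=> [herm psd tr1] uU; have uT := kron1_unitary n (bra_unitary uU).
have tr1' : \tr (in_basis U rho) = 1.
  by rewrite /in_basis mxtrace_mulC mulmxA adjmx_unitaryV // mul1mx.
have hS : adjmx (in_basis U rho) = in_basis U rho.
  by rewrite /in_basis !adjmxM adjmxK herm mulmxA.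
rewrite -tr1' -tr_blk; apply: eq_bigr => k _; apply: trnorm_psd.
  apply/matrixP => b c.
  by rewrite adjmxE [blk _ _ _ c b]mxE [RHS]mxE -[in RHS]hS adjmxE.
apply: blk_diag_psd => v; have := psd (v *m kron (bra U) 1%:M).
by rewrite adjmxM /in_basis !mulmxA.
Qed.

Lemma negativity_meas_state n (U : 'M[C]_2) (rho : 'M[C]_(2 * n)) :
  is_state rho -> onb U ->
  negativity_AB_A' (meas_state U rho) = trnorm (rho - dephase U rho) / 2%:R.
Proof.
move=> rhoS uU; have := sum_trnorm_blk_diag rhoS uU.
rewrite /negativity_AB_A' trnorm_meas_state //.
rewrite (trnorm_offdiag (kron1_unitary n (bra_unitary uU)) (sub_dephaseE rho uU)).
set S := in_basis U rho; rewrite !big_ord_recl !big_ord0 !addr0.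
have -> : lift ord0 ord0 = 1 :> 'I_2 by apply/val_inj.
(* The diagonal blocks contribute exactly the 1 subtracted in the negativity. *)
by move=> tr1; congr (_ / _); rewrite -tr1; ring.
Qed.

End Pointwise.

(** * Matrices with polynomial entries *)

Section PolynomialMatrices.
Variables (C : numClosedFieldType) (J : finType).

Definition polymx m n (A : {ffun J -> realC C} -> 'M[C]_(m, n)) :=
  forall i j, polyfun (fun x => A x i j).

Lemma polymx_cst m n (A : 'M[C]_(m, n)) : polymx (fun=> A).
Proof. by move=> i j; apply: PolyCst. Qed.

Lemma polymx_sub m n (A B : {ffun J -> realC C} -> 'M[C]_(m, n)) :
  polymx A -> polymx B -> polymx (fun x => A x - B x).
Proof.
move=> pA pB i j; apply: PolyExt (PolyAdd (pA i j) (polyfun_opp (pB i j))) => x.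
by rewrite !mxE.
Qed.

Lemma polymx_sum (I : Type) (r : seq I) m n
    (A : I -> {ffun J -> realC C} -> 'M[C]_(m, n)) :
  (forall k, polymx (A k)) -> polymx (fun x => \sum_(k <- r) A k x).
Proof.
move=> pA i j.
apply: PolyExt (polyfun_sum (P := xpredT) r (fun k _ => pA k i j)) => x.
by rewrite summxE.
Qed.

Lemma polymx_mul m n p (A : {ffun J -> realC C} -> 'M[C]_(m, n))
    (B : {ffun J -> realC C} -> 'M[C]_(n, p)) :
  polymx A -> polymx B -> polymx (fun x => A x *m B x).
Proof.
move=> pA pB i j.
apply: PolyExt (polyfun_sum (P := xpredT) (index_enum _)
  (fun k _ => PolyMul (pA i k) (pB k j))) => x.
by rewrite mxE.
Qed.

Lemma polymx_adj m n (A : {ffun J -> realC C} -> 'M[C]_(m, n)) :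
  polymx A -> polymx (fun x => adjmx (A x)).
Proof.
by move=> pA i j; apply: PolyExt (PolyConj (pA j i)) => x; rewrite adjmxE.
Qed.

Lemma polymx_kron m n p q (A : {ffun J -> realC C} -> 'M[C]_(m, n))
    (B : {ffun J -> realC C} -> 'M[C]_(p, q)) :
  polymx A -> polymx B -> polymx (fun x => kron (A x) (B x)).
Proof.
move=> pA pB i j; apply: PolyExt (PolyMul (pA _ _) (pB _ _)) => x.
by rewrite [RHS]mxE.
Qed.

Lemma polymx_sub_dephase d n (A : {ffun J -> realC C} -> 'M[C]_d)
    (rho : 'M[C]_(d * n)) :
  polymx A -> polymx (fun x => rho - dephase (A x) rho).
Proof.
move=> pA; apply: polymx_sub; first exact: polymx_cst.
apply: polymx_sum => k.
have pk : polymx (fun x => kron (proj (A x) k) (1%:M : 'M[C]_n)).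
  apply: polymx_kron; last exact: polymx_cst.
  have pket : polymx (fun x => ket (A x) k).
    by move=> i j; apply: PolyExt (pA k i) => x; rewrite !mxE.
  by apply: polymx_mul => //; apply: polymx_adj.
by apply: polymx_mul => //; apply: polymx_mul => //; apply: polymx_cst.
Qed.

End PolynomialMatrices.

(** * Matrix equations as scalar polynomial equations *)

Section SquaredNorm.
Variable C : numClosedFieldType.

(** The squared Frobenius norm, written with conjugates so as to be a polynomial function. *)
Definition sqnorm_mx m n (A : 'M[C]_(m, n)) : C :=
  \sum_i \sum_j A i j * (A i j)^*.

Lemma sqnorm_mx_ge0 m n (A : 'M[C]_(m, n)) : 0 <= sqnorm_mx A.
Proof.
by apply: sumr_ge0 => i _; apply: sumr_ge0 => j _; rewrite -normCK exprn_ge0.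
Qed.

Lemma sqnorm_mx_eq0 m n (A : 'M[C]_(m, n)) : (sqnorm_mx A == 0) = (A == 0).
Proof.
apply/idP/eqP => [|->]; last first.
  by apply/eqP; apply: big1 => i _; apply: big1 => j _; rewrite mxE mul0r.
have ge0 i j : 0 <= A i j * (A i j)^* by rewrite -normCK exprn_ge0.
rewrite psumr_eq0 => [/allP h|i _]; last exact: sumr_ge0.
apply/matrixP => i j; have := h i (mem_index_enum _); rewrite /= psumr_eq0 //.
move=> /allP/(_ j (mem_index_enum _)) /=.
by rewrite -normCK expf_eq0 /= normr_eq0 mxE => /eqP.
Qed.

Lemma polyfun_sqnorm (J : finType) m n
    (A : {ffun J -> realC C} -> 'M[C]_(m, n)) :
  polymx A -> polyfun (fun x => sqnorm_mx (A x)).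
Proof.
move=> pA; apply: polyfun_sum => i _; apply: polyfun_sum => j _.
by apply: PolyMul (pA i j) (PolyConj (pA i j)).
Qed.

Lemma unitary_entry_le1 n (U : 'M[C]_n) i j : U \is unitarymx -> `|U i j| <= 1.
Proof.
move=> /adjmx_unitaryP/matrixP/(_ i i).
rewrite !mxE eqxx (bigD1 j) //= adjmxE -normCK => h.
rewrite -(@expr_le1 _ 2) // -[leRHS]h lerDl sumr_ge0 // => k _.
by rewrite adjmxE -normCK exprn_ge0.
Qed.

End SquaredNorm.

(** * Existence of the minimum *)

Section TraceNormMinimum.
Variables (C : numClosedFieldType) (d m : nat).

(* Unknowns: the value [t] of the trace norm, the unitary [U], a unitary [P]
   diagonalising [X^* X] for [X = D U], and square roots [w] of the singular
   values of [X]; each complex unknown stands for two real coordinates. *)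
Let unknown : finType := (unit + 'I_d * 'I_d + 'I_m * 'I_m + 'I_m)%type.
Let J : finType := (unknown * bool)%type.
Implicit Types (x : {ffun J -> realC C}).

Let cplx x (i : unknown) : C :=
  realval (x (i, false)) + 'i * realval (x (i, true)).
Let valt x : C := cplx x (inl (inl (inl tt))).
Let valU x : 'M[C]_d := \matrix_(i, j) cplx x (inl (inl (inr (i, j)))).
Let valP x : 'M[C]_m := \matrix_(i, j) cplx x (inl (inr (i, j))).
Let valw x : 'rV[C]_m := \row_i cplx x (inr i).

(** A singular value is encoded as |w_i|^2, so that its nonnegativity holds without an inequality in
    the system. *)
Let sqw x i : C := valw x 0 i * (valw x 0 i)^*.

Let mkpoint (t : C) (U : 'M[C]_d) (P : 'M[C]_m) (w : 'rV[C]_m) :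
    {ffun J -> realC C} :=
  [ffun p => let z := match p.1 with
     | inl (inl (inl _)) => t
     | inl (inl (inr ij)) => U ij.1 ij.2
     | inl (inr ij) => P ij.1 ij.2
     | inr i => w 0 i end in
   if p.2 then RealC (Creal_Im z) else RealC (Creal_Re z)].

Let mkpointK t U P w :
  [/\ valt (mkpoint t U P w) = t, valU (mkpoint t U P w) = U,
  valP (mkpoint t U P w) = P & valw (mkpoint t U P w) = w].
Proof.
split; [|apply/matrixP => i j|apply/matrixP => i j|apply/rowP => i];
  by rewrite ?mxE /valt /cplx !ffunE /= -Crect.
Qed.

Let mkpoint_box t (U : 'M[C]_d) (P : 'M[C]_m) (w : 'rV[C]_m) (M : C) :
    `|t| <= M -> (forall i j, `|U i j| <= M) -> (forall i j, `|P i j| <= M) ->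
    (forall i, `|w 0 i| <= M) ->
  in_box M (mkpoint t U P w).
Proof.
have reim (z : C) (b : bool) : `|z| <= M ->
    `|realval (if b then RealC (Creal_Im z) else RealC (Creal_Re z))| <= M.
  case: b => zM; apply: le_trans zM; last exact: (leif_normC_Re_Creal z).1.
  (* The imaginary part is bounded as minus the real part of i z. *)
  have := (leif_normC_Re_Creal ('i * z)).1.
  by rewrite ReMil normrN normrM normCi mul1r.
move=> tM UM PM wM [[[[u|[i j]]|[i j]]|i] b]; rewrite ffunE; exact: reim.
Qed.

Let polyfun_cplx i : polyfun (fun x => cplx x i).
Proof.
by apply: PolyAdd (PolyCoord _ _) (PolyMul (PolyCst _ _) (PolyCoord _ _)).
Qed.

(** The trace norm becomes a coordinate on the zero set of one polynomial function, where it is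
    minimised within a box. Polynomiality of [D] is expressed as preservation of [polymx]. *)
Lemma trnorm_unitary_min (D : 'M[C]_d -> 'M[C]_m) :
    (forall (I : finType) (A : {ffun I -> realC C} -> 'M[C]_d),
       polymx A -> polymx (fun y => D (A y))) ->
  exists2 U : 'M[C]_d, U \is unitarymx &
    forall V, V \is unitarymx -> trnorm (D U) <= trnorm (D V).
Proof.
move=> polyD.
have polyU : polymx valU.
  by move=> i j; apply: PolyExt (polyfun_cplx _) => x; rewrite mxE.
have polyP : polymx valP.
  by move=> i j; apply: PolyExt (polyfun_cplx _) => x; rewrite mxE.
have polyw i : polyfun (fun x => sqw x i).
  by apply: PolyMul; [|apply: PolyConj]; apply: PolyExt (polyfun_cplx _) => x;
    rewrite mxE.
(* The four equations say that U and P are unitary, that P diagonalises the Gram matrix with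
   eigenvalues |w_i|^4, and that t is the sum of the |w_i|^2. As a sum of squared norms, [F]
   vanishes exactly when all four hold. *)
pose E1 x := valU x *m adjmx (valU x) - 1%:M.
pose E2 x := valP x *m adjmx (valP x) - 1%:M.
pose E3 x := valP x *m (adjmx (D (valU x)) *m D (valU x)) *m adjmx (valP x)
  - diag_mx (\row_i (sqw x i ^+ 2)).
pose E4 x : 'M[C]_1 := (valt x - \sum_i sqw x i)%:M.
pose F x :=
  sqnorm_mx (E1 x) + sqnorm_mx (E2 x) + sqnorm_mx (E3 x) + sqnorm_mx (E4 x).
have polyF : polyfun F.
  have pD := polyD _ _ polyU.
  apply: PolyAdd; [apply: PolyAdd; [apply: PolyAdd|]|]; apply: polyfun_sqnorm.
  - apply: polymx_sub; last exact: polymx_cst.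
    by apply: polymx_mul => //; apply: polymx_adj.
  - apply: polymx_sub; last exact: polymx_cst.
    by apply: polymx_mul => //; apply: polymx_adj.
  - apply: polymx_sub.
      apply: polymx_mul; last exact: polymx_adj.
      by apply: polymx_mul => //; apply: polymx_mul => //; apply: polymx_adj.
    move=> i j; have [->|ij] := eqVneq i j.
      by apply: PolyExt (PolyMul (polyw j) (polyw j)) => x; rewrite !mxE eqxx.
    by apply: PolyExt (PolyCst _ 0) => x; rewrite !mxE (negPf ij).
  move=> i j; rewrite !ord1.
  apply: PolyExt (PolyAdd (polyfun_cplx (inl (inl (inl tt)))) (polyfun_opp
    (polyfun_sum (P := xpredT) (index_enum _) (fun i _ => polyw i)))) => x.
  by rewrite mxE.
have F0 x : F x = 0 <-> [/\ valU x \is unitarymx, valP x \is unitarymx,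
    valP x *m (adjmx (D (valU x)) *m D (valU x)) *m adjmx (valP x)
      = diag_mx (\row_i (sqw x i ^+ 2)) & valt x = \sum_i sqw x i].
  split=> [/eqP|[/adjmx_unitaryP h1 /adjmx_unitaryP h2 h3 h4]]; last first.
    apply/eqP; rewrite !paddr_eq0 ?addr_ge0 ?sqnorm_mx_ge0 // !sqnorm_mx_eq0.
    by rewrite /E1 /E2 /E3 /E4 h1 h2 h3 h4 !subrr raddf0 !eqxx.
  rewrite !paddr_eq0 ?addr_ge0 ?sqnorm_mx_ge0 // !sqnorm_mx_eq0 -!andbA !subr_eq0.
  case/and4P=> /eqP h1 /eqP h2 /eqP h3 /eqP h4.
  split=> //; try exact/adjmx_unitaryP.
  by apply/eqP; rewrite -subr_eq0; move/matrixP/(_ 0 0)/eqP: h4; rewrite !mxE.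
have sqw_ge0 x i : 0 <= sqw x i by rewrite /sqw -normCK exprn_ge0.
(* On the zero set t is real, so the trace norm is the single real coordinate to be minimised. *)
have F0_trnorm x : F x = 0 ->
    trnorm (D (valU x)) = realval (x (inl (inl (inl tt)), false)).
  move=> /F0[_ uP PE tE].
  rewrite (trnorm_diag uP ((unitary_diag_conj _ _ uP).2 PE)).
  have -> : \sum_i sqrtC ((\row_i sqw x i ^+ 2) 0 i) = valt x.
    by rewrite tE; apply: eq_bigr => i _; rewrite mxE sqrCK.
  have : valt x \is Num.real by rewrite tE rpred_sum // => i _; apply: ger0_real.
  by move=> /Creal_ReP <-; rewrite /valt /cplx Re_rect ?realvalP.
(* Every unitary whose trace norm is at most [M] lifts to a zero of [F] in the box. *)
have point V (M : realC C) :
    V \is unitarymx -> 1 <= realval M -> trnorm (D V) <= realval M ->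
    exists x, [/\ F x = 0, in_box (realval M) x & valU x = V].
  move=> uV M1 VM; have [P [s [uP s0 PE sE]]] := trnorm_decomp (D V).
  pose w := map_mx sqrtC s; exists (mkpoint (trnorm (D V)) V P w).
  have [tK UK PK wK] := mkpointK (trnorm (D V)) V P w.
  have sqwE i : sqw (mkpoint (trnorm (D V)) V P w) i = s 0 i.
    by rewrite /sqw wK -normCK mxE ger0_norm ?sqrtC_ge0 ?sqrtCK.
  have tr0 : 0 <= trnorm (D V) by rewrite sE sumr_ge0.
  split=> //; last first.
    apply: mkpoint_box => [|i j|i j|i]; first by rewrite ger0_norm.
    - exact: le_trans (unitary_entry_le1 _ _ uV) M1.
    - exact: le_trans (unitary_entry_le1 _ _ uP) M1.
    (* Here |w_i|^2 = s_i is at most the trace norm, hence at most M <= M^2. *)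
    rewrite mxE ger0_norm ?sqrtC_ge0 // -(@ler_pXn2r _ 2) ?nnegrE ?sqrtC_ge0 //;
      last exact: le_trans M1.
    rewrite sqrtCK (@le_trans _ _ (realval M)) //.
      apply: le_trans VM; rewrite sE (bigD1 i) //= lerDl sumr_ge0 //.
    by rewrite expr2 ler_peMr // (le_trans _ M1).
  apply/F0; rewrite tK UK PK; split=> //.
    by rewrite PE; congr diag_mx; apply/rowP => i; rewrite !mxE sqwE.
  by rewrite (eq_bigr _ (fun i _ => sqwE i)).
have trnorm_ge0 V : 0 <= trnorm (D V).
  by have [P [s [_ s0 _ ->]]] := trnorm_decomp (D V); rewrite sumr_ge0.
have u1 : (1%:M : 'M[C]_d) \is unitarymx.
  by apply/adjmx_unitaryP; rewrite mul1mx adjmx1.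
pose c0 := trnorm (D 1%:M); have c0_ge0 : 0 <= c0 by apply: trnorm_ge0.
(* The summand 1 makes room for the entries of unitaries, and [c0] for all trace norms up to the
   value at the identity. *)
have M0 : 0 <= 1 + c0 by rewrite addr_ge0.
pose M := RealC (ger0_real M0).
have M1 : 1 <= realval M by rewrite /= lerDl.
have cM : c0 <= realval M by rewrite /= lerDr.
have [x1 [Fx1 x1M x1U]] := point _ M u1 M1 cM.
have [x [Fx xM xmin]] := polyfun_min_coord (inl (inl (inl tt)), false) polyF
  (ex_intro2 _ _ x1 Fx1 x1M).
exists (valU x); first by have /F0[] := Fx.
have min_c0 : trnorm (D (valU x)) <= c0.
  by rewrite /c0 -x1U !F0_trnorm //; apply: xmin.
move=> V uV; rewrite (F0_trnorm x) //.
(* A unitary with value above [c0] may fall outside the box, but the minimum found is at most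
   [c0]. *)
have /orP[Vc|cV] : (trnorm (D V) <= c0) || (c0 <= trnorm (D V)).
- by apply: real_leVge; apply: ger0_real.
- have [y [Fy yM <-]] := point V M uV M1 (le_trans Vc cM).
  by rewrite F0_trnorm //; apply: xmin.
- by rewrite -F0_trnorm //; apply: le_trans cV.
Qed.

End TraceNormMinimum.

Theorem theorem7 (C : numClosedFieldType) (n : nat) (rho : 'M[C]_(2 * n))
  (hrho : is_state rho) :
  exists q : C,
    QN_is rho q /\
    is_min_onb (fun U : 'M[C]_2 => trnorm (rho - dephase U rho) / 2%:R) q.
Proof.
have [U uU Umin] := @trnorm_unitary_min C 2 _ (fun U => rho - dephase U rho)
  (fun I A pA => polymx_sub_dephase rho pA).
exists (trnorm (rho - dephase U rho) / 2%:R).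
have le2 (V : 'M[C]_2) : onb V -> trnorm (rho - dephase U rho) / 2%:R
    <= trnorm (rho - dephase V rho) / 2%:R.
  by move=> uV; rewrite ler_pM2r ?invr_gt0 ?ltr0n // Umin.
split; split; first by exists U => //; rewrite negativity_meas_state.
- by move=> V uV; rewrite negativity_meas_state // le2.
- by exists U.
- exact: le2.
Qed.
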